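(* The axiom system $\mathcal{R}$ consisting of (R1), (R2), (R3), (R4), (R5), (R6), (R8$'$), (R9), (R10) is equivalent to Tarski's system (R1)--(R10). That is, an algebra $\mathfrak{A}=(A,+,-,;,{}^{\smile},1')$ satisfies all axioms of $\mathcal{R}$ if and only if it satisfies all of (R1)--(R10).
   Context: All algebras have the form $\mathfrak{A}=(A,+,-,;,{}^{\smile},1')$, where $A$ is a non-empty set, $+$ and $;$ are binary operations on $A$, $-$ and ${}^{\smile}$ are unary operations on $A$, and $1'$ is a distinguished element of $A$. Unary operations bind more tightly than binary ones, and $;$ binds more tightly than $+$. An algebra satisfies an axiom if the axiom holds for all elements $r,s,t\in A$. The axioms are: (R1) $r+s=s+r$; (R2) $r+(s+t)=(r+s)+t$; (R3) $-(-r+s)+-(-r+-s)=r$; (R4) $r;(s;t)=(r;s);t$; (R5) $r;1'=r$; (R6) $(r^{\smile})^{\smile}=r$; (R7) $(r;s)^{\smile}=s^{\smile};r^{\smile}$; (R8) $(r+s);t=r;t+s;t$; (R9) $(r+s)^{\smile}=r^{\smile}+s^{\smile}$; (R10) $r^{\smile};-(r;s)+-s=-s$, i.e. $\bigl((r^{\smile});(-(r;s))\bigr)+(-s)=-s$; and the left-hand distributive law (R8$'$) $r;(s+t)=r;s+r;t$. So $\mathcal{R}$ is obtained from (R1)--(R10) by dropping (R7) and replacing (R8) by (R8$'$). *)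

(* Defs.v *)
(* Vanilla Rocq: only the prelude is needed. *)

(* The similarity type of relation algebras; no laws are imposed.  The carrier
   is automatically non-empty, since it contains [ident]. *)
Record algebra : Type := Algebra {
  carrier :> Type;
  add : carrier -> carrier -> carrier;
  compl : carrier -> carrier;
  comp : carrier -> carrier -> carrier;
  conv : carrier -> carrier;
  ident : carrier
}.

Arguments add {_} _ _.
Arguments compl {_} _.
Arguments comp {_} _ _.
Arguments conv {_} _.
Arguments ident {_}.

Declare Scope relalg_scope.
Delimit Scope relalg_scope with ra.

(* Unary operations bind tighter than [;;], which binds tighter than [+].
   Relative multiplication is written [;;] since [;] is a reserved separator. *)
Notation "r + s" := (add r s) (at level 50, left associativity) : relalg_scope.
Notation "r ;; s" := (comp r s) (at level 40, left associativity) : relalg_scope.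
Notation "- r" := (compl r) (at level 35, right associativity) : relalg_scope.
Notation "r ^~" := (conv r) (at level 1, left associativity, format "r ^~") : relalg_scope.
Notation "1'" := ident (at level 0) : relalg_scope.

Local Open Scope relalg_scope.

Definition R1 (A : algebra) : Prop := forall r s : A, r + s = s + r.

Definition R2 (A : algebra) : Prop :=
  forall r s t : A, r + (s + t) = (r + s) + t.

Definition R3 (A : algebra) : Prop :=
  forall r s : A, - (- r + s) + - (- r + - s) = r.

Definition R4 (A : algebra) : Prop :=
  forall r s t : A, r ;; (s ;; t) = (r ;; s) ;; t.

Definition R5 (A : algebra) : Prop := forall r : A, r ;; 1' = r.

Definition R6 (A : algebra) : Prop := forall r : A, (r^~)^~ = r.

Definition R7 (A : algebra) : Prop :=
  forall r s : A, (r ;; s)^~ = s^~ ;; r^~.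

Definition R8 (A : algebra) : Prop :=
  forall r s t : A, (r + s) ;; t = r ;; t + s ;; t.

Definition R8' (A : algebra) : Prop :=
  forall r s t : A, r ;; (s + t) = r ;; s + r ;; t.

Definition R9 (A : algebra) : Prop :=
  forall r s : A, (r + s)^~ = r^~ + s^~.

Definition R10 (A : algebra) : Prop :=
  forall r s : A, r^~ ;; - (r ;; s) + - s = - s.

Definition tarski_system (A : algebra) : Prop :=
  R1 A /\ R2 A /\ R3 A /\ R4 A /\ R5 A /\ R6 A /\ R7 A /\ R8 A /\ R9 A /\ R10 A.

(* (R7) is dropped and (R8) is replaced by (R8'). *)
Definition system_R (A : algebra) : Prop :=
  R1 A /\ R2 A /\ R3 A /\ R4 A /\ R5 A /\ R6 A /\ R8' A /\ R9 A /\ R10 A.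

(* Main.v *)
(** Write [x <= y] for [x + y = y].  Given (R8'), axiom (R10) says that the maps
    [s |-> r ;; s] and [t |-> r^~ ;; t] are conjugate: [r ;; s <= - t] iff
    [r^~ ;; t <= - s].  By associativity both [(r ;; s)^~ ;; _] and
    [s^~ ;; r^~ ;; _] are conjugate to [r ;; s ;; _].  Conjugates are unique, so
    evaluating at [1'] gives (R7), and (R7) with (R6) and (R9) makes the two
    distributive laws interchangeable. *)
From Stdlib Require Import Setoid.
Require Import Defs.

Local Open Scope relalg_scope.

Lemma addACA (A : algebra) (h1 : R1 A) (h2 : R2 A) (a b c d : A) :
  (a + b) + (c + d) = (a + c) + (b + d).
Proof.
  rewrite <- (h2 a b), (h2 b c), (h1 b c), <- (h2 c b), (h2 a c).
  reflexivity.
Qed.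

(** Splitting [x] and [- x] along [- y] by (R3) gives four terms; splitting [y] and [- y] along
    [- x] gives the same four. *)
Lemma add_compl_const (A : algebra) (h1 : R1 A) (h2 : R2 A) (h3 : R3 A)
    (x y : A) : x + - x = y + - y.
Proof.
  transitivity ((- (- x + - y) + - (- x + - - y)) +
                (- (- - x + - y) + - (- - x + - - y))).
  { rewrite !h3. reflexivity. }
  transitivity ((- (- y + - x) + - (- y + - - x)) +
                (- (- - y + - x) + - (- - y + - - x))).
  2: { rewrite !h3. reflexivity. }
  rewrite (addACA A h1 h2), (h1 (- - x) (- y)), (h1 (- x) (- y)).
  rewrite (h1 (- x) (- - y)), (h1 (- - x) (- - y)).
  reflexivity.
Qed.

Lemma complK (A : algebra) (h1 : R1 A) (h2 : R2 A) (h3 : R3 A) (x : A) :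
  - - x = x.
Proof.
  (* (R3) splits [- - x] along [- x]; the resulting terms are those of [x] split along [- - x]. *)
  transitivity (- (- - - x + - x) + - (- - - x + - - x)).
  { symmetry. apply h3. }
  rewrite (h1 (- - - x) (- - x)), (add_compl_const A h1 h2 h3 (- - x) (- x)).
  rewrite (h1 (- - - x) (- x)), h1.
  apply h3.
Qed.

(** Once [- one] is shown to be neutral, [hx] at [- x] reads [- x = - (x + x)]. *)
Lemma add_idem (A : algebra) (h1 : R1 A) (h2 : R2 A) (h3 : R3 A) (x : A) :
  x + x = x.
Proof.
  pose proof (complK A h1 h2 h3) as hK.
  pose proof (add_compl_const A h1 h2 h3) as hc.
  set (one := x + - x).
  assert (hone : forall y, y + - y = one) by (intro y; apply hc).
  assert (hx : forall y, y = - one + - (- y + - y)).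
  { intro y. rewrite <- (h3 y y) at 1.
    rewrite (h1 (- y) y), hone. reflexivity. }
  assert (h11 : one + one = one).
  (* Adding [one] to [e] shows that [one] absorbs [- (one + one)]. *)
  { assert (e : - one = - one + - (one + one)).
    { rewrite (hx (- one)) at 1. rewrite hK. reflexivity. }
    assert (e' : one = one + - (one + one)).
    { rewrite <- (hone one) at 1. rewrite e, h2, hone. reflexivity. }
    rewrite <- (hone (one + one)) at 3.
    rewrite <- h2, <- e'. reflexivity. }
  assert (h00 : - one + - one = - one).
  { rewrite (hx (- one)) at 3. rewrite hK, h11. reflexivity. }
  assert (h0 : forall y, - one + y = y).
  { intro y. rewrite (hx y) at 1. rewrite h2, h00. symmetry. apply hx. }
  assert (e := hx (- x)).
  rewrite hK, h0 in e.
  rewrite <- (hK (x + x)), <- e. apply hK.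
Qed.

Lemma compl_anti (A : algebra) (h1 : R1 A) (h2 : R2 A) (h3 : R3 A) (x y : A) :
  x + y = y -> - y + - x = - x.
Proof.
  intro hxy.
  (* (R3) exhibits [- y] as a summand of [- x]; idempotence then absorbs it. *)
  assert (e : - x = - y + - (x + - y)).
  { rewrite <- (h3 (- x) y) at 1.
    rewrite (complK A h1 h2 h3), hxy. reflexivity. }
  rewrite e, h2, (add_idem A h1 h2 h3). reflexivity.
Qed.

Lemma le_compl_swap (A : algebra) (h1 : R1 A) (h2 : R2 A) (h3 : R3 A)
    (x y : A) : x + - y = - y -> y + - x = - x.
Proof.
  intro h.
  pose proof (compl_anti A h1 h2 h3 _ _ h) as e.
  rewrite (complK A h1 h2 h3) in e. exact e.
Qed.

(** Every element is a complement, so [x] and [y] have the same upper bounds and lie below each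
    other. *)
Lemma eq_of_le_compl_iff (A : algebra) (h1 : R1 A) (h2 : R2 A) (h3 : R3 A)
    (x y : A) : (forall u, x + - u = - u <-> y + - u = - u) -> x = y.
Proof.
  intro h.
  assert (hxy : forall u, x + u = u <-> y + u = u).
  { intro u. rewrite <- (complK A h1 h2 h3 u). apply h. }
  pose proof (proj1 (hxy x) (add_idem A h1 h2 h3 x)) as e1.
  pose proof (proj2 (hxy y) (add_idem A h1 h2 h3 y)) as e2.
  rewrite <- e1, h1. exact e2.
Qed.

(** From [t <= - (r ;; s)], monotonicity by (R8') and then (R10) give
    [r^~ ;; t <= r^~ ;; - (r ;; s) <= - s]. *)
Lemma comp_le_compl (A : algebra) (h1 : R1 A) (h2 : R2 A) (h3 : R3 A)
    (h8 : R8' A) (h10 : R10 A) (r s t : A) :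
  r ;; s + - t = - t -> r^~ ;; t + - s = - s.
Proof.
  intro h.
  apply (le_compl_swap A h1 h2 h3) in h.
  rewrite <- (h10 r s), h2, <- h8, h.
  reflexivity.
Qed.

Lemma conv_comp (A : algebra) (h : system_R A) : R7 A.
Proof.
  destruct h as (h1 & h2 & h3 & h4 & h5 & h6 & h8 & h9 & h10).
  pose proof (le_compl_swap A h1 h2 h3) as swap.
  assert (conj : forall r s t : A,
             r^~ ;; t + - s = - s <-> r ;; s + - t = - t).
  { intros r s t; split; intro h.
    - rewrite <- (h6 r). apply comp_le_compl; assumption.
    - apply comp_le_compl; assumption. }
  intros r s.
  rewrite <- (h5 ((r ;; s)^~)), <- (h5 (s^~ ;; r^~)), <- h4.
  apply (eq_of_le_compl_iff A h1 h2 h3); intro u.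
  (* Both sides now say that [s ;; u] and [r^~ ;; 1'] are disjoint, in opposite orders. *)
  rewrite (conj (r ;; s)), (conj s), <- h4, <- conj.
  split; apply swap.
Qed.

Lemma comp_add_distr_swap (A : algebra) (h6 : R6 A) (h7 : R7 A) (h9 : R9 A) :
  R8 A <-> R8' A.
Proof.
  split; intros h r s t.
  - rewrite <- (h6 (r ;; (s + t))), h7, h9, h, h9, !h7, !h6. reflexivity.
  - rewrite <- (h6 ((r + s) ;; t)), h7, h9, h, h9, !h7, !h6. reflexivity.
Qed.

Theorem theorem2 (A : algebra) : system_R A <-> tarski_system A.
Proof.
  split.
  - intro h. pose proof (conv_comp A h) as h7.
    destruct h as (h1 & h2 & h3 & h4 & h5 & h6 & h8 & h9 & h10).
    pose proof (proj2 (comp_add_distr_swap A h6 h7 h9) h8).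
    repeat split; assumption.
  - intros (h1 & h2 & h3 & h4 & h5 & h6 & h7 & h8 & h9 & h10).
    pose proof (proj1 (comp_add_distr_swap A h6 h7 h9) h8).
    repeat split; assumption.
Qed.
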